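(* Let $X$ be a complete metric space and $(w_1,\ldots,w_N)$ be a collection of contracting homeomorphisms of $X$ onto $X$. If $(w_1,\ldots,w_N)$ satisfies the strong open set condition (SOSC), then $(w_1,\ldots,w_N)\in\bigcap_{n=1}^{\infty}\mathcal V_n$, or, equivalently, $(w_1,\ldots,w_N)$ satisfies the strong Markov property (SMP).
   Context: $\mathbb N=\{1,2,\ldots\}$, $N\in\mathbb N$, and $d$ is the distance in $X$. A mapping $w:X\to X$ is contracting if $\sigma(w)=\sup_{x\neq y\in X}\frac{d(w(x),w(y))}{d(x,y)}<1$. $\mathcal M(X)$ denotes the set of all contracting homeomorphisms of $X$ onto itself. For $(w_1,\ldots,w_N)\in(\mathcal M(X))^N$, the attractor $A=A(w_1,\ldots,w_N)$ is the unique non-empty compact subset of $X$ with $A=\bigcup_{i=1}^N w_i(A)$. Let $\Sigma=\{1,\ldots,N\}$, and for $\mathbf i=(i_1,\ldots,i_n)\in\Sigma^n$ let $w_{\mathbf i}=w_{i_1}\circ\cdots\circ w_{i_n}$. The system satisfies the open set condition (OSC) if there is a non-empty open set $\mathcal O\subset X$ with $w_i(\mathcal O)\cap w_j(\mathcal O)=\emptyset$ for $i\neq j$ and $w_i(\mathcal O)\subset\mathcal O$ for $i=1,\ldots,N$. It satisfies the strong open set condition (SOSC) if it satisfies the OSC with such an $\mathcal O$ for which in addition $\mathcal O\cap A\neq\emptyset$. For $n\in\mathbb N$, $\mathcal V_n$ is the set of all ordered $N$-tuples $(w_1,\ldots,w_N)\in(\mathcal M(X))^N$ such that for every $\mathbf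 i\in\Sigma^n$, $w_{\mathbf i}(A)\nsubseteq\bigcup_{\mathbf j\in\Sigma^n,\ \mathbf j\neq\mathbf i}w_{\mathbf j}(A)$. The system satisfies the strong Markov property (SMP) if for every $n\in\mathbb N$ there is an open set $\mathcal O_n\subset X$ such that (1) $\overline{\mathcal O_n\cap A}=A$; and (2) $w_{\mathbf i}(\mathcal O_n)\cap w_{\mathbf j}(\mathcal O_n)=\emptyset$ for all $\mathbf i\neq\mathbf j\in\Sigma^n$. *)

(* Defs.v *)
From HB Require Import structures.
From mathcomp Require Import all_boot all_order all_algebra.
From mathcomp Require Import boolp classical_sets reals constructive_ereal ereal.
From mathcomp Require Import topology.

Set Implicit Arguments.
Unset Strict Implicit.
Unset Printing Implicit Defensive.

Import Order.TTheory GRing.Theory Num.Theory.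
Local Open Scope classical_set_scope.
Local Open Scope ring_scope.

(* [Complete] contains [Pointed], so the spaces below are nonempty; this is
   also necessary for attractors to exist. *)
#[short(type="completeMetricType")]
HB.structure Definition CompleteMetric (R : numDomainType) :=
  {T of Complete T & Metric R T}.

Section IteratedFunctionSystem.
Context {R : realType} {X : completeMetricType R}.

(* The supremum is taken in [\bar R]: it is [+oo] when the ratios are unbounded
   (the supremum in [R] would then default to 0) and [-oo] when [X] is a single
   point, in which case every self-map is contracting. *)
Definition contraction_ratio (f : X -> X) : \bar R :=
  ereal_sup [set (mdist (f p.1) (f p.2) / mdist p.1 p.2)%:E
            | p in [set p : X * X | p.1 <> p.2]].

Definition contracting (f : X -> X) : Prop := (contraction_ratio f < 1%:E)%E.

Definition homeomorphism (f : X -> X) : Prop :=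
  continuous f /\
  exists g : X -> X, [/\ cancel f g, cancel g f & continuous g].

Definition contracting_homeo : set (X -> X) :=
  [set f | contracting f /\ homeomorphism f].

Section System.
Context {N : nat} (w : 'I_N -> X -> X).

Definition is_attractor (A : set X) : Prop :=
  [/\ A !=set0, compact A & A = \bigcup_(i : 'I_N) (w i @` A)].

(* For [0 < N] and contracting [w i], exactly one set satisfies [is_attractor]
   (Hutchinson), so the default value [set0] plays no role. *)
Definition attractor : set X := xget set0 [set A | is_attractor A].

Definition word_map (s : seq 'I_N) : X -> X :=
  foldr (fun i f => w i \o f) id s.

Definition osc_set (O : set X) : Prop :=
  [/\ open O, O !=set0,
      forall i j : 'I_N, i <> j -> (w i @` O) `&` (w j @` O) = set0
    & forall i : 'I_N, w i @` O `<=` O].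

Definition SOSC : Prop :=
  exists O : set X, osc_set O /\ O `&` attractor !=set0.

Definition SMP : Prop :=
  forall n : nat, (0 < n)%N ->
  exists O : set X,
    [/\ open O,
        closure (O `&` attractor) = attractor
      & forall s t : n.-tuple 'I_N, s <> t ->
          (word_map s @` O) `&` (word_map t @` O) = set0].

End System.

Definition V (N n : nat) : set ('I_N -> X -> X) :=
  [set w | (forall i, contracting_homeo (w i)) /\
     forall s : n.-tuple 'I_N,
       ~ (word_map w s @` attractor w `<=`
          \bigcup_(t in [set t : n.-tuple 'I_N | t <> s])
             (word_map w t @` attractor w))].

End IteratedFunctionSystem.

Arguments V {R X} N n.

(* Main.v *)
Require Import Defs.
From HB Require Import structures.
From mathcomp Require Import all_boot all_order all_algebra.
From mathcomp Require Import boolp classical_sets reals constructive_ereal ereal.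
From mathcomp Require Import topology.
From mathcomp Require Import cardinality sequences.

(** Write [A] for the attractor and [w_s] for the map of a word [s].

    A non-empty attractor has to be known to exist: for the default value
    [set0], the empty set [O] would witness the strong Markov property while
    every [V N n] would fail.
    A large closed ball [B] is mapped into itself by the Hutchinson operator,
    so its iterates [K n] decrease. Each [K n] is a finite union of pieces
    [w_s @` B] of diameter at most [2 r c ^+ n], with [r] the radius of [B] and
    [c < 1] a common Lipschitz constant. Hence an ultrafilter containing every
    [K n] contains arbitrarily small pieces, is Cauchy, and converges to a
    point of [\bigcap_n K n] ([ultra_iter_cvg]). That single fact gives both
    non-emptiness and compactness of the intersection, and the invariance
    follows from the pigeonhole principle ([attractor_exists]).

    Strong open set condition implies strong Markov: one set [O] serves for all
    lengths. The images of [O] under distinct words of equal length are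
    disjoint ([osc_set_words]), and the orbit of a point of [O `&` A] under the
    words stays in [O `&` A] and is dense in [A], because every point of [A]
    lies in small pieces [w_u @` A] ([attractor_small_piece],
    [osc_set_dense]).

    Strong Markov implies membership in every [V N n]: for [x] in [O `&` A],
    the point [w_s x] lies in the open set [w_s @` O]; were it [w_t a] with [a]
    in [A], points of [O] close to [a] would be sent by [w_t] into [w_s @` O],
    against disjointness ([separated_word_image_notin]).

    Membership in every [V N n] implies strong Markov: around the pieces
    [w_s @` A] there are pairwise disjoint open cells, each containing the
    points of its piece that lie in no other piece. The set of points sent by
    each [w_s] into the cell of [s] is open, and the images of this set are
    disjoint. It meets [A] densely: as finitely many open sets are involved
    ([dense_in_bigcap_fin]), each [s] can be treated alone, and inside any small
    piece [w_u @` A] the condition applied to the longer word [s ++ u] yields a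
    point that [w_s] sends outside all other pieces
    ([essential_words_separated]). *)

Local Open Scope classical_set_scope.

Set Implicit Arguments.
Unset Strict Implicit.
Unset Printing Implicit Defensive.

Import Order.TTheory GRing.Theory Num.Theory.
Import numFieldTopology.Exports.
Local Open Scope ring_scope.

(** * Topological preliminaries *)

Section Topology.

Lemma ultra_bigcup_fin (T : Type) (I : finType) (B : I -> set T)
    (F : set_system T) :
  UltraFilter F -> F (\bigcup_i B i) -> exists i, F (B i).
Proof.
move=> FU FB; apply: contrapT => nF.
have : \near F, forall i, (~` B i) F.
  apply: filter_forall => i.
  by have [FBi|//] := in_ultra_setVsetC (B i) FU; case: nF; exists i.
move=> FC; have [x [[i _ Bx] /(_ i)]] := filter_ex (filterI FB FC).
exact.
Qed.

Lemma homeomorphism_imageE (R : realType) (X : completeMetricType R)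
    (f : X -> X) : homeomorphism f ->
  exists2 g : X -> X, continuous g & forall E, f @` E = g @^-1` E.
Proof.
move=> [_ [g [fK gK cg]]]; exists g => // E.
apply/seteqP; split=> [_ [x Ex <-]|x Ex] /=; first by rewrite fK.
by exists (g x).
Qed.

Lemma homeomorphism_image_open (R : realType) (X : completeMetricType R)
    (f : X -> X) (O : set X) : homeomorphism f -> open O -> open (f @` O).
Proof.
move=> /homeomorphism_imageE[g cg fE] oO.
by rewrite fE; apply: open_comp => // x _; exact: cg.
Qed.

Lemma homeomorphism_image_closed (R : realType) (X : completeMetricType R)
    (f : X -> X) (E : set X) : homeomorphism f -> closed E -> closed (f @` E).
Proof.
move=> /homeomorphism_imageE[g cg fE] cE.
by rewrite fE; apply: preimage_closed => // x _; exact: cg.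
Qed.

(** Finite Baire property relative to [A]. By induction: a neighbourhood of a
    point of [A] contains a point of [D i `&` A], and openness of [D i] lets
    the remaining sets be treated inside [D i]. *)
Lemma dense_in_bigcap_fin (T : topologicalType) (A : set T) (I : finType)
    (D : I -> set T) :
  (forall i, open (D i)) -> (forall i, A `<=` closure (D i `&` A)) ->
  A `<=` closure ((\bigcap_i D i) `&` A).
Proof.
move=> oD dD.
suff H (s : seq I) : A `<=` closure ([set x | {in s, forall i, D i x}] `&` A).
  move=> a /(H (enum I)); apply: closureS => x [Dx Ax]; split=> // i _.
  by apply: Dx; rewrite mem_enum.
elim: s => [|i s IHs] a Aa; first by apply: subset_closure; split.
move=> B /nbhs_interior nB; have [b [[Dib Ab] Bb]] := dD i a Aa _ nB.
have nb : nbhs b (D i `&` B).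
  apply: filterI; first exact: (open_nbhs_nbhs (conj (oD i) Dib)).
  exact: Bb.
have [x [[Dx Ax] [Dix Bx]]] := IHs b Ab _ nb.
exists x; split=> //; split=> // j; rewrite inE => /predU1P[->//|].
exact: Dx.
Qed.

Lemma geometric_small (R : realType) (c M e : R) :
  0 <= c < 1 -> 0 < e -> exists n, c ^+ n * M < e.
Proof.
move=> /andP[c0 c1] e0.
have [M0|M0] := leP M 0.
  by exists 0%N; rewrite expr0 mul1r (le_lt_trans M0).
have := @cvg_expr R c; rewrite ger0_norm// => /(_ c1).
move=> /cvg_ballP/(_ (e / M)) [|n _ /(_ n)]; first by rewrite divr_gt0.
rewrite /= leqnn => /(_ isT); rewrite /ball /= distrC subr0.
rewrite ger0_norm ?exprn_ge0//.
by exists n; rewrite -ltr_pdivlMr.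
Qed.

End Topology.

Section Metric.
Context {R : realType} {X : metricType R}.

Definition dist_ball (x0 : X) (r : R) : set X := [set y | mdist x0 y <= r].

Lemma dist_ball_closed x0 r : closed (dist_ball x0 r).
Proof.
rewrite -openC openE => y /= /negP; rewrite -ltNge => ry.
apply/nbhs_ballP; exists (mdist x0 y - r) => /=; first by rewrite subr_gt0.
move=> z; rewrite ballEmdist /= => yz; apply/negP; rewrite -ltNge.
move: yz; rewrite ltrBrDr addrC -ltrBrDr => /lt_le_trans; apply.
by rewrite lerBlDr (metric_sym y z) metric_triangle.
Qed.

Lemma compact_dist_bounded (A : set X) (x0 : X) :
  compact A -> exists M, forall y, A y -> mdist x0 y <= M.
Proof.
rewrite compact_near_coveringP.
move=> /(_ nat \oo (fun n y => mdist x0 y <= n%:R) _).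
case=> [x Ax|n _ /(_ n)].
  have [n xn] : exists n : nat, mdist x0 x + 1 <= n%:R.
    exists (Num.bound (mdist x0 x + 1)); apply/ltW/archi_boundP.
    by rewrite addr_ge0// mdist_ge0.
  exists (ball x 1, [set m | (n <= m)%N]).
    by split; [exact: nbhsx_ballx | exists n].
  move=> [y m] /= []; rewrite ballEmdist /= => xy nm.
  rewrite (le_trans (metric_triangle _ x _))//.
  rewrite (le_trans (lerD (lexx _) (ltW xy)))// (le_trans xn)//.
  by rewrite ler_nat.
by rewrite /= leqnn => /(_ isT) An; exists n%:R => y Ay; exact: An.
Qed.

(** The halved radius is what makes cells of distinct indices disjoint: if two
    such balls met, their centres would be closer than the larger of the two
    values of [r], which is a lower bound for their distance. *)
Definition cell (I : Type) (C : I -> set X) (i : I) : set X :=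
  [set z | exists y r, [/\ 0 < r, C i y,
    forall j, j <> i -> forall y', C j y' -> r <= mdist y y'
    & ball y (r / 2) z]].

Lemma cell_disjoint (I : Type) (C : I -> set X) (i j : I) :
  i <> j -> cell C i `&` cell C j = set0.
Proof.
move=> ij; rewrite -subset0.
move=> z [[y [r [r0 Cy Hy yz]]] [y' [r' [r'0 Cy' Hy' y'z]]]].
have ij' : j <> i by exact/nesym.
have h1 := Hy j ij' y' Cy'; have h2 := Hy' i ij y Cy.
move: yz y'z h2; rewrite !ballEmdist /= => yz y'z; rewrite metric_sym => h2.
have := metric_triangle y z y'; rewrite (metric_sym z y') leNgt => /negP; apply.
have := ltrD yz y'z; move/lt_le_trans; apply.
by rewrite [leRHS]splitr lerD// ler_pM2r// invr_gt0.
Qed.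

Lemma cell_open (I : Type) (C : I -> set X) (i : I) : open (cell C i).
Proof.
rewrite openE => z [y [r [r0 Cy Hy yz]]]; apply/nbhs_ballP.
move: yz; rewrite ballEmdist /= => yz.
exists (r / 2 - mdist y z) => /=; first by rewrite subr_gt0.
move=> t zt; exists y, r; split=> //; move: zt; rewrite !ballEmdist /= => zt.
by rewrite (le_lt_trans (metric_triangle y z t))// -ltrBrDl.
Qed.

Lemma mem_cell (I : Type) (C : I -> set X) (i : I) (y : X) :
  C i y -> closed (\bigcup_(j in [set j | j <> i]) C j) ->
  ~ (\bigcup_(j in [set j | j <> i]) C j) y -> cell C i y.
Proof.
move=> Cy cF nF.
have : nbhs y (~` (\bigcup_(j in [set j | j <> i]) C j)).
  by apply: open_nbhs_nbhs; split=> //; exact: closed_openC.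
case/nbhs_ballP => r /= r0 rF; exists y, r; split=> //; last first.
  by apply: ballxx; rewrite divr_gt0.
move=> j ij y' Cy'; rewrite leNgt; apply/negP => yy'.
by apply: (rF y'); [rewrite ballEmdist | exists j].
Qed.

End Metric.

(** * Words and the open set condition *)

Section System.
Context {R : realType} {X : completeMetricType R} {N : nat}.
Variable w : 'I_N -> X -> X.

Definition hutchinson (E : set X) : set X := \bigcup_(i : 'I_N) (w i @` E).

Lemma hutchinson_subset (E E' : set X) :
  E `<=` E' -> hutchinson E `<=` hutchinson E'.
Proof.
by move=> EE' x [i _ [y Ey <-]]; exists i => //; exists y => //; exact: EE'.
Qed.

Lemma word_map_cat (s t : seq 'I_N) :
  word_map w (s ++ t) = word_map w s \o word_map w t.
Proof. by elim: s => //= i s ->. Qed.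

(** Iterating the Hutchinson operator is taking the images under all words of
    the given length: the first form is suited to monotonicity arguments, the
    second to estimates of diameters. *)
Lemma iter_hutchinson (n : nat) (E : set X) :
  iter n hutchinson E = \bigcup_(s : n.-tuple 'I_N) (word_map w s @` E).
Proof.
elim: n => [|n IHn] /=.
  apply/seteqP; split=> [x Ex|_ [s _ [x Ex <-]]]; last by rewrite tuple0.
  by exists [tuple] => //; exists x.
rewrite IHn; apply/seteqP; split.
  move=> _ [i _ [_ [s _ [x Ex <-]] <-]].
  by exists [tuple of i :: s] => //; exists x.
move=> _ [s _ [x Ex <-]]; case/tupleP: s => i s.
by exists i => //; exists (word_map w s x) => //; exists s.
Qed.

Lemma word_map_invariant (E : set X) (s : seq 'I_N) :
  (forall i, w i @` E `<=` E) -> word_map w s @` E `<=` E.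
Proof.
move=> wE; elim: s => [|i s IHs] _ [x Ex <-] //=.
by apply: (wE i); exists (word_map w s x) => //; apply: IHs; exists x.
Qed.

Lemma is_attractor_iter (A : set X) (n : nat) :
  is_attractor w A -> iter n hutchinson A = A.
Proof. by move=> [_ _ wA]; elim: n => //= n ->. Qed.

Lemma is_attractor_words (A : set X) (n : nat) :
  is_attractor w A -> A = \bigcup_(s : n.-tuple 'I_N) (word_map w s @` A).
Proof. by move=> hA; rewrite -iter_hutchinson is_attractor_iter. Qed.

Lemma is_attractor_word_subset (A : set X) (s : seq 'I_N) :
  is_attractor w A -> word_map w s @` A `<=` A.
Proof.
move=> [_ _ wA]; apply: word_map_invariant => i x wx.
by rewrite wA; exists i.
Qed.

Lemma is_attractor_closed (A : set X) : is_attractor w A -> closed A.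
Proof.
by move=> [_ cA _]; apply: compact_closed => //; exact: metric_hausdorff.
Qed.

Hypothesis w_homeo : forall i, homeomorphism (w i).

Lemma word_map_homeo (s : seq 'I_N) : homeomorphism (word_map w s).
Proof.
elim: s => [|i s [cs [g [sK gK cg]]]].
  by split; [move=> x; exact: cvg_id | exists id; split=> // x; exact: cvg_id].
have [ci [h [iK hK ch]]] := w_homeo i; split=> /=.
  move=> x; apply: (@continuous_comp _ _ _ (word_map w s) (w i)).
    exact: cs.
  exact: ci.
exists (g \o h); split=> [x|x|x] /=; rewrite ?iK ?sK ?gK ?hK //.
by apply: (@continuous_comp _ _ _ h g); [exact: ch|exact: cg].
Qed.

Lemma word_map_inj (s : seq 'I_N) : injective (word_map w s).
Proof. by have [_ [g [sK _ _]]] := word_map_homeo s; exact: can_inj sK. Qed.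

(** At the first letter where the words differ the images are separated by the
    open set condition; what follows stays inside [O], and the common prefix is
    injective. *)
Lemma osc_set_words (O : set X) (s t : seq 'I_N) :
  osc_set w O -> size s = size t -> s <> t ->
  (word_map w s @` O) `&` (word_map w t @` O) = set0.
Proof.
move=> [_ _ dO wO]; rewrite -subset0.
elim: s t => [|i s IHs] [|j t] //= [st] ijst _ [[x Ox <-] [y Oy]] /= wyx.
have Os u z : O z -> O (word_map w u z).
  by move=> Oz; apply: (word_map_invariant wO); exists z.
have [ij|ij] := pselect (i = j).
  rewrite -ij in wyx ijst; have wi : injective (w i) := @word_map_inj [:: i].
  have st' : s <> t by move=> st'; apply: ijst; rewrite st'.
  apply: (IHs t st st' (word_map w s x)); split; first by exists x.
  by exists y => //; exact: wi.
have : ((w i @` O) `&` (w j @` O)) (w i (word_map w s x)).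
  by split; [exists (word_map w s x) | exists (word_map w t y)];
    rewrite //; exact: Os.
by rewrite dO.
Qed.

(** Since [w_s @` O] is open and [w_t] is continuous, an equality
    [w_s x = w_t a] with [a] adherent to [O] would spread to a point of
    [(w_s @` O) `&` (w_t @` O)]. *)
Lemma separated_word_image_notin (A O : set X) (s t : seq 'I_N) (x : X) :
  open O -> A `<=` closure O -> O x ->
  (word_map w s @` O) `&` (word_map w t @` O) = set0 ->
  ~ (word_map w t @` A) (word_map w s x).
Proof.
move=> oO AO Ox st0 [a Aa tasx].
have oS : open (word_map w s @` O).
  exact: homeomorphism_image_open (word_map_homeo s) oO.
have [ct _] := word_map_homeo t.
have nS : nbhs a (word_map w t @^-1` (word_map w s @` O)).
  apply: ct; apply: open_nbhs_nbhs; split=> //.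
  by rewrite tasx; exists x.
have [y [Oy sy]] := AO a Aa _ nS.
suff : set0 (word_map w t y) by [].
by rewrite -st0; split=> //; exists y.
Qed.

End System.

(** * Contraction rates *)

Section Contraction.
Context {R : realType} {X : completeMetricType R}.

(** The supremum of the ratios is [-oo] when [X] is a single point; [fine] and
    the maximum with [0] turn it into a valid Lipschitz constant. *)
Lemma contracting_lipschitz (f : X -> X) : contracting f ->
  exists2 c : R, 0 <= c < 1 & forall x y, mdist (f x) (f y) <= c * mdist x y.
Proof.
rewrite /contracting; set q := contraction_ratio f => q1.
exists (Num.max 0 (fine q)).
  rewrite le_max lexx /= gt_max ltr01 /=.
  by case: q q1 => //= r; rewrite ?lte_fin.
move=> x y; have [->|/eqP xy] := eqVneq x y; first by rewrite !mdistxx mulr0.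
have d0 : 0 < mdist x y by rewrite mdist_gt0; apply/eqP.
have : ((mdist (f x) (f y) / mdist x y)%:E <= q)%E.
  by apply: ereal_sup_ubound; exists (x, y).
rewrite -ler_pdivrMr// le_max.
by case: q q1 => //= r _; rewrite lee_fin => ->; rewrite orbT.
Qed.

Context {N : nat} (w : 'I_N -> X -> X).

Lemma contracting_family_lipschitz : (forall i, contracting (w i)) ->
  exists2 c : R, 0 <= c < 1 &
    forall i x y, mdist (w i x) (w i y) <= c * mdist x y.
Proof.
move=> /(fun H i => cid2 (contracting_lipschitz (H i))) c.
exists (\big[Num.max/0]_i s2val (c i)).
  apply/andP; split; first exact: bigmax_ge_id.
  by apply: bigmax_lt => // i _; case/andP: (s2valP (c i)).
move=> i x y; rewrite (le_trans (s2valP' (c i) x y))//.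
by rewrite ler_wpM2r ?mdist_ge0// le_bigmax.
Qed.

Lemma word_map_lipschitz (c : R) : 0 <= c ->
  (forall i x y, mdist (w i x) (w i y) <= c * mdist x y) ->
  forall s x y,
    mdist (word_map w s x) (word_map w s y) <= c ^+ size s * mdist x y.
Proof.
move=> c0 cw; elim=> [|i s IHs] x y /=; first by rewrite expr0 mul1r.
by rewrite (le_trans (cw _ _ _))// exprS -mulrA ler_wpM2l.
Qed.

End Contraction.

(** * Existence and fine structure of the attractor *)

Section Hutchinson.
Context {R : realType} {X : completeMetricType R} {N : nat}.
Variable w : 'I_N -> X -> X.
Hypothesis w_homeo : forall i, homeomorphism (w i).
Variable c : R.
Hypothesis c01 : 0 <= c < 1.
Hypothesis w_lip : forall i x y, mdist (w i x) (w i y) <= c * mdist x y.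

(** The radius [S / (1 - c)] is the least [r] with [S + c * r <= r], where [S]
    bounds every displacement of the centre. *)
Lemma invariant_dist_ball (x0 : X) :
  exists r, 0 <= r /\ hutchinson w (dist_ball x0 r) `<=` dist_ball x0 r.
Proof.
case/andP: c01 => c0 c1; have c1' : 0 < 1 - c by rewrite subr_gt0.
pose S := \sum_i mdist x0 (w i x0).
have S0 : 0 <= S by apply: sumr_ge0 => i _; exact: mdist_ge0.
exists (S / (1 - c)); split; first by rewrite divr_ge0// ltW.
move=> _ [i _ [y /= yr <-]].
have iS : mdist x0 (w i x0) <= S.
  by rewrite /S (bigD1 i)//= lerDl sumr_ge0// => j _; exact: mdist_ge0.
rewrite /dist_ball /= (le_trans (metric_triangle _ (w i x0) _))//.
rewrite (le_trans (lerD iS (w_lip i x0 y)))//.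
rewrite (le_trans (lerD (lexx S) (ler_wpM2l c0 yr)))//.
have St : S = (1 - c) * (S / (1 - c)) by rewrite mulrC divfK// gt_eqF.
by rewrite [X in X + _]St -mulrDl subrK mul1r.
Qed.

Lemma hutchinson_closed (E : set X) : closed E -> closed (hutchinson w E).
Proof.
move=> cE; apply: closed_bigcup => [|i _]; first exact: finite_finset.
exact: homeomorphism_image_closed.
Qed.

(** An ultrafilter contains a piece of each finite union it contains; the
    pieces of [iter n (hutchinson w) B] are uniformly small, so the ultrafilter
    is Cauchy. *)
Lemma ultra_iter_cvg (x0 : X) (r : R) (F : set_system X) :
  UltraFilter F ->
  (forall n, F (iter n (hutchinson w) (dist_ball x0 r))) ->
  exists p, F --> p /\ forall n, iter n (hutchinson w) (dist_ball x0 r) p.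
Proof.
move=> FU FK; have FP := ultra_proper; case/andP: c01 => c0 c1.
have : cvg F.
  apply: cauchy_cvg; apply: cauchy_exP => e e0.
  have [n nre] := geometric_small r c01 e0.
  move: (FK n); rewrite iter_hutchinson => /ultra_bigcup_fin[s Fs].
  exists (word_map w s x0); apply: filterS Fs => _ [y yr <-].
  rewrite ballEmdist /=.
  rewrite (le_lt_trans (word_map_lipschitz c0 w_lip s x0 y))//.
  by rewrite size_tuple (le_lt_trans _ nre)// ler_wpM2l// exprn_ge0.
move=> /cvg_ex[p Fp]; exists p; split=> // n.
have cK : closed (iter n (hutchinson w) (dist_ball x0 r)).
  by elim: n => [|n]; [exact: dist_ball_closed|exact: hutchinson_closed].
exact: (closed_cvg (F := F) (u_ := id) _ cK (FK n)).
Qed.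

(** The attractor is the intersection of the iterates of an invariant ball;
    non-emptiness uses an ultrafilter finer than the filter they generate. *)
Lemma attractor_exists : (0 < N)%N -> exists A, is_attractor w A.
Proof.
move=> N0; pose x0 : X := point; have [r [r0 Hr]] := invariant_dist_ball x0.
pose K n := iter n (hutchinson w) (dist_ball x0 r).
have KS n : K n.+1 `<=` K n.
  by elim: n => [|n IHn]; [exact: Hr|exact: hutchinson_subset].
have Kmon m n : (m <= n)%N -> K n `<=` K m.
  move=> /subnK <-; elim: (n - m)%N => // k IHk.
  by rewrite addSn; apply: subset_trans IHk; exact: KS.
have Kne n : K n !=set0.
  elim: n => [|n [x Kx]]; first by exists x0; rewrite /K /dist_ball /= mdistxx.
  by exists (w (Ordinal N0) x); exists (Ordinal N0) => //; exists x.
have FK : Filter (filter_from setT K).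
  apply: filter_fromT_filter; first by exists 0%N.
  move=> i j; exists (maxn i j); rewrite subsetI.
  by split; apply: Kmon; rewrite ?leq_maxl ?leq_maxr.
have PK : ProperFilter (filter_from setT K) by exact: filter_from_proper.
exists (\bigcap_n K n); split.
- have [G [GU KG]] := ultraFilterLemma PK.
  have [|p [_ Kp]] := @ultra_iter_cvg x0 r G GU.
    by move=> n; apply: KG; exists n.
  by exists p => n _; exact: Kp.
- rewrite compact_ultra => F FU FA.
  have [|p [Fp Kp]] := @ultra_iter_cvg x0 r F FU.
    by move=> n; have FP := ultra_proper; apply: filterS FA; apply: bigcap_inf.
  by exists p; split=> // n _; exact: Kp.
- apply/seteqP; split=> [x Kx|_ [i _ [x Kx <-]] n _]; last first.
    by apply: KS; exists i => //; exists x => //; exact: Kx.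
  (* Finitely many maps and decreasing [K n]: the same [i] serves for all [n],
     and injectivity makes the preimage of [x]
     independent of [n]. *)
  have [i iK] : exists i, forall n, (w i @` K n) x.
    apply: contrapT => nK.
    have /choice[m mK] : forall i, exists m, ~ (w i @` K m) x.
      move=> i; apply: contrapT => nm; apply: nK; exists i => n.
      by apply: contrapT => nx; apply: nm; exists n.
    have [i _ [y Ky yx]] := Kx (\max_i m i).+1 I.
    by apply: (mK i); exists y => //; apply: Kmon Ky; exact: leq_bigmax.
  have [y Ky yx] := iK 0%N; exists i => //; exists y => // n _.
  have [z Kz] := iK n; rewrite -yx => /(word_map_inj w_homeo (s := [:: i])).
  by move=> <-.
Qed.

(** [A] is the union of its pieces of each given length [n], whose diameters
    decrease like [c ^+ n] because [A] is bounded. *)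
Lemma attractor_small_piece (A : set X) (a : X) (e : R) :
  is_attractor w A -> A a -> 0 < e ->
  exists (n : nat) (u : n.-tuple 'I_N),
    (word_map w u @` A) a /\ word_map w u @` A `<=` ball a e.
Proof.
move=> hA Aa e0; case/andP: c01 => c0 c1; have [_ cA _] := hA.
have [M AM] := compact_dist_bounded a cA.
have [n ne] := geometric_small (M + M) c01 e0.
move: Aa; rewrite [in A a](is_attractor_words n hA) => -[u _ [b Ab ba]].
exists n, u; split; first by exists b.
move=> _ [y Ay <-]; rewrite ballEmdist /= -ba.
rewrite (le_lt_trans (word_map_lipschitz c0 w_lip u b y))//.
rewrite size_tuple (le_lt_trans _ ne)// ler_wpM2l ?exprn_ge0//.
rewrite (le_trans (metric_triangle _ a _))// lerD//; last exact: AM.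
by rewrite metric_sym AM.
Qed.

(** A small piece [w_u @` A] near a point of [A] contains [w_u x], where [x] is
    in [O `&` A], and [w_u] maps [O] and [A] into themselves. *)
Lemma osc_set_dense (A O : set X) :
  is_attractor w A -> osc_set w O -> O `&` A !=set0 ->
  closure (O `&` A) = A.
Proof.
move=> hA [oO _ _ wO] [x [Ox Ax]]; apply/seteqP; split=> [|a Aa].
  apply: subset_trans (is_attractor_closed hA).
  by apply: closureS; exact: subIsetr.
move=> B /nbhs_ballP[e /= e0 eB].
have [n [u [_ uB]]] := attractor_small_piece hA Aa e0.
exists (word_map w u x); split; last by apply/eB/uB; exists x.
split; first by apply: (word_map_invariant wO); exists x.
by apply: (is_attractor_word_subset hA); exists x.
Qed.

(** A point [w_(s ++ u) b] outside the pieces of all other words of its length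
    is also outside [w_t @` A] for each [t <> s] of length [n], as such a piece
    is the union of pieces of words [t ++ v]. So [w_s] sends [w_u b] into the
    cell of [s], and [w_u b] is as close to a prescribed point of [A] as the
    piece [w_u @` A] is small. *)
Lemma essential_words_separated (A : set X) (n : nat) :
  is_attractor w A ->
  (forall m (s : m.-tuple 'I_N), (0 < m)%N -> ~ (word_map w s @` A `<=`
     \bigcup_(t in [set t : m.-tuple 'I_N | t <> s]) (word_map w t @` A))) ->
  (0 < n)%N ->
  exists O : set X, [/\ open O, closure (O `&` A) = A &
     forall s t : n.-tuple 'I_N, s <> t ->
       (word_map w s @` O) `&` (word_map w t @` O) = set0].
Proof.
move=> hA VA n0.
pose C (s : n.-tuple 'I_N) := word_map w s @` A.
pose D (s : n.-tuple 'I_N) := word_map w s @^-1` cell C s.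
have oD s : open (D s).
  apply: open_comp; last exact: cell_open.
  by move=> x _; exact: (word_map_homeo w_homeo s).1.
have clA := is_attractor_closed hA.
exists (\bigcap_s D s); split.
- rewrite openE => x Dx.
  have : \near x, forall s, D s x.
    apply: filter_forall => s.
    exact: (open_nbhs_nbhs (conj (oD s) (Dx s I))).
  by apply: filterS => y Dy s _; exact: Dy.
- apply/seteqP; split.
    by apply: subset_trans clA; apply: closureS; exact: subIsetr.
  apply: dense_in_bigcap_fin => // s a Aa B /nbhs_ballP[e /= e0 eB].
  have [m [u [_ uB]]] := attractor_small_piece hA Aa e0.
  have := VA _ [tuple of s ++ u]; rewrite addn_gt0 n0 => /(_ isT).
  move=> /existsNP[_ /not_implyP[[b Ab <-]] nb].
  have Aub : A (word_map w u b).
    by apply: (is_attractor_word_subset hA); exists b.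
  exists (word_map w u b); split; last by apply/eB/uB; exists b.
  split=> //; apply: mem_cell; first by exists (word_map w u b).
    apply: closed_bigcup => [|t _]; first exact: finite_finset.
    by apply: homeomorphism_image_closed => //; exact: word_map_homeo.
  move=> [t /= ts [y Ay]]; rewrite [in A y](is_attractor_words m hA) in Ay.
  case: Ay => v _ [z Az <-] tvz; apply: nb; exists [tuple of t ++ v].
    move=> /= /(congr1 val) /= /eqP; rewrite eqseq_cat ?size_tuple//.
    by case/andP => /eqP/val_inj.
  by exists z => //=; rewrite !word_map_cat /=.
- move=> s t st; rewrite -subset0 => _ [[x Dx <-] [y Dy xy]].
  suff : set0 (word_map w s x) by [].
  rewrite -(cell_disjoint C st); split; first exact: Dx.
  by rewrite -xy; exact: Dy.
Qed.

End Hutchinson.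

Theorem proposition1 (R : realType) (X : completeMetricType R) (N : nat)
    (w : 'I_N -> X -> X)
    (N_gt0 : (0 < N)%N)
    (w_contracting : forall i : 'I_N, contracting_homeo (w i)) :
  (SOSC w -> (\bigcap_(n in [set n : nat | (0 < n)%N]) V N n) w) /\
  ((\bigcap_(n in [set n : nat | (0 < n)%N]) V N n) w <-> SMP w).
Proof.
have w_homeo i : homeomorphism (w i) by case: (w_contracting i).
have [c c01 w_lip] : exists2 c : R, 0 <= c < 1 &
    forall i x y, mdist (w i x) (w i y) <= c * mdist x y.
  by apply: contracting_family_lipschitz => i; case: (w_contracting i).
have hA : is_attractor w (attractor w).
  exact: xgetPex (attractor_exists w_homeo c01 w_lip N_gt0).
have SMP_V : SMP w -> (\bigcap_(n in [set n : nat | (0 < n)%N]) V N n) w.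
  move=> smp n n0; split=> // s.
  have [O [oO AO dO]] := smp n n0.
  have [x [Ox Ax]] : O `&` attractor w !=set0.
    have [[a Aa] _ _] := hA; rewrite -AO in Aa.
    by have [x [? _]] := Aa _ filterT; exists x.
  have AclO : attractor w `<=` closure O.
    by rewrite -[X in X `<=` _]AO; apply: closureS; exact: subIsetl.
  move=> /(_ (word_map w s x))[|t /= ts]; first by exists x.
  apply: (separated_word_image_notin w_homeo oO AclO Ox).
  by apply: dO; exact/nesym.
split; last first.
  split=> // VA n n0.
  apply: (essential_words_separated w_homeo c01 w_lip) => // m s m0.
  exact: (VA m m0).2.
move=> [O [oscO OA]]; apply: SMP_V => n n0; exists O; split.
- by case: oscO.
- exact: (osc_set_dense c01 w_lip) OA.
- move=> s t st; apply: osc_set_words => //; rewrite ?size_tuple//.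
  by move=> /val_inj.
Qed.
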